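(* Let $A_i, B_i, C_i, D_i \in \mathbb{C}^{n\times n}$ for $i=1,2$, and consider the two-parameter eigenvalue problem $$ \left\{ \begin{array}{l} A_1x=\lambda B_1x+\mu C_1x+\lambda\mu D_1x,\\ A_2y=\lambda B_2y+\mu C_2y+\lambda\mu D_2y. \end{array} \right. $$ If $(\lambda,\mu)\in\mathbb{C}^2$ is a solution (eigenvalue) of this problem with corresponding eigenvector $(x,y)$, $x,y\in\mathbb{C}^n\setminus\{0\}$, then: 1. $\lambda$ is an eigenvalue, with corresponding eigenvector $x\otimes y$, of the quadratic eigenvalue problem $$ \big[\lambda^2(D_1\otimes B_2-B_1\otimes D_2)+\lambda(A_1\otimes D_2-D_1\otimes A_2-B_1\otimes C_2+C_1\otimes B_2)+(A_1\otimes C_2-C_1\otimes A_2)\big](x\otimes y)=0. $$ 2. $\mu$ is an eigenvalue, with corresponding eigenvector $x\otimes y$, of the quadratic eigenvalue problem $$ \big[\mu^2(D_1\otimes C_2-C_1\otimes D_2)+\mu(A_1\otimes D_2-D_1\otimes A_2-C_1\otimes B_2+B_1\otimes C_2)+(A_1\otimes B_2-B_1\otimes A_2)\big](x\otimes y)=0. $$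
   Context: $\otimes$ denotes the Kronecker product. A pair $(\lambda,\mu)\in\mathbb{C}^2$ is a solution (eigenvalue) of a two-parameter eigenvalue problem with corresponding eigenvector $(x,y)$ (also written $x\otimes y$) if $x,y\in\mathbb{C}^n$ are nonzero and both equations hold. For matrices $M_0,M_1,M_2\in\mathbb{C}^{N\times N}$, a scalar $\theta\in\mathbb{C}$ is an eigenvalue with eigenvector $z\neq 0$ of the quadratic eigenvalue problem given by $\theta^2M_2+\theta M_1+M_0$ if $(\theta^2M_2+\theta M_1+M_0)z=0$; no regularity of the matrix polynomial is assumed. *)

(* Defs.v *)
From mathcomp Require Import all_boot all_order all_algebra.
From mathcomp Require Import reals.
From mathcomp.real_closed Require Export complex mxtens.

Set Implicit Arguments.
Unset Strict Implicit.
Unset Printing Implicit Defensive.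

Import GRing.Theory.
Local Open Scope ring_scope.
Local Open Scope complex_scope.

Section EigenvalueProblems.
Variable R : realType.
Local Notation C := R[i].

Definition two_parameter_eigenpair (n : nat)
    (A1 B1 C1 D1 A2 B2 C2 D2 : 'M[C]_n) (lambda mu : C) (x y : 'cV[C]_n) : Prop :=
  [/\ x != 0, y != 0,
      A1 *m x = lambda *: (B1 *m x) + mu *: (C1 *m x) + (lambda * mu) *: (D1 *m x)
    & A2 *m y = lambda *: (B2 *m y) + mu *: (C2 *m y) + (lambda * mu) *: (D2 *m y)].

(* No regularity of the matrix polynomial is assumed. *)
Definition quadratic_eigenpair (N : nat) (M2 M1 M0 : 'M[C]_N)
    (theta : C) (z : 'cV[C]_N) : Prop :=
  z != 0 /\ (theta ^+ 2 *: M2 + theta *: M1 + M0) *m z = 0.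

End EigenvalueProblems.

(* [x *t y] lives in ['M_(n * n, 1 * 1)]; this retypes it, by conversion, as a column vector. *)
Definition kron_vec (R : realType) (n : nat) (x y : 'cV[R[i]]_n) : 'cV[R[i]]_(n * n) :=
  x *t y.

(* Main.v *)
Require Import Defs.
From mathcomp Require Import all_boot all_order all_algebra.
From mathcomp Require Import reals ring.
From mathcomp.real_closed Require Import complex mxtens.

(** Fix [lambda] and collect the terms in [mu]: the system becomes a pair of
    linear pencils sharing the eigenvalue [mu],
      [(A1 - lambda B1) x = mu (C1 + lambda D1) x],
      [(A2 - lambda B2) y = mu (C2 + lambda D2) y].
    Tensor the left side of the first with the right factor of the second, and
    conversely: both products equal [mu (C1 + lambda D1) x *t (C2 + lambda D2) y].
    Hence the operator determinant
      [(A1 - lambda B1) *t (C2 + lambda D2) - (C1 + lambda D1) *t (A2 - lambda B2)]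
    annihilates [x *t y] ([pencil_determinant_kernel]), and expanding it in powers
    of [lambda] gives the quadratic matrix polynomial of the first claim
    ([pencil_determinantE]).  The second claim is the first one with the roles of
    [(lambda, B1, B2)] and [(mu, C1, C2)] exchanged, under which the system is
    invariant. *)

Import GRing.Theory.
Local Open Scope ring_scope.
Local Open Scope complex_scope.

Lemma tensmx_neq0 (R : idomainType) (m n p q : nat)
    (A : 'M[R]_(m, n)) (B : 'M[R]_(p, q)) :
  A != 0 -> B != 0 -> A *t B != 0.
Proof.
case/matrix0Pn=> i [k Aik] /matrix0Pn[j [l Bjl]].
apply/matrix0Pn; exists (mxtens_index (i, j)), (mxtens_index (k, l)).
by rewrite tensmxE mulf_neq0.
Qed.

(** Under the Kronecker product [mu] can be moved from one tensor factor
    to the other, so the two products applied to [u *t v] coincide, with no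
    division by [mu]. *)
Lemma pencil_determinant_kernel (R : comPzRingType) (m n p q r s : nat)
    (P Q : 'M[R]_(m, n)) (S T : 'M[R]_(p, q))
    (mu : R) (u : 'M[R]_(n, r)) (v : 'M[R]_(q, s)) :
  P *m u = mu *: (Q *m u) -> S *m v = mu *: (T *m v) ->
  (P *t T - Q *t S) *m (u *t v) = 0.
Proof.
move=> Pu Sv; rewrite mulmxBl !tensmx_mul Pu Sv.
by apply/matrixP=> i j; rewrite !mxE mulrCA mulrA subrr.
Qed.

Lemma pencil_determinantE (R : comPzRingType) (m n p q : nat)
    (A1 B1 C1 D1 : 'M[R]_(m, n)) (A2 B2 C2 D2 : 'M[R]_(p, q)) (t : R) :
  t ^+ 2 *: (D1 *t B2 - B1 *t D2)
    + t *: (A1 *t D2 - D1 *t A2 - B1 *t C2 + C1 *t B2)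
    + (A1 *t C2 - C1 *t A2)
  = (A1 - t *: B1) *t (C2 + t *: D2) - (C1 + t *: D1) *t (A2 - t *: B2).
Proof. by apply/matrixP=> i j; rewrite !mxE; ring. Qed.

Lemma quadratic_eigenpair_first (R : realType) (n : nat)
    (A1 B1 C1 D1 A2 B2 C2 D2 : 'M[R[i]]_n)
    (lambda mu : R[i]) (x y : 'cV[R[i]]_n) :
  two_parameter_eigenpair A1 B1 C1 D1 A2 B2 C2 D2 lambda mu x y ->
  quadratic_eigenpair
    (D1 *t B2 - B1 *t D2)
    (A1 *t D2 - D1 *t A2 - B1 *t C2 + C1 *t B2)
    (A1 *t C2 - C1 *t A2)
    lambda (kron_vec x y).
Proof.
case=> x0 y0 eqx eqy; split.
  exact: (@tensmx_neq0 _ _ _ _ _ x y).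
(* Collecting in [mu] is where each equation becomes a linear pencil. *)
have pencil A B C D (z : 'cV[R[i]]_n) :
    A *m z = lambda *: (B *m z) + mu *: (C *m z) + (lambda * mu) *: (D *m z) ->
    (A - lambda *: B) *m z = mu *: ((C + lambda *: D) *m z).
  move=> eqz; rewrite mulmxBl mulmxDl -!scalemxAl eqz scalerDr scalerA.
  by apply: (canLR (addrK _)); rewrite [mu * lambda]mulrC [RHS]addrC addrA.
rewrite pencil_determinantE.
by apply: (@pencil_determinant_kernel _ _ _ _ _ _ _ _ _ _ _ mu x y); apply: pencil.
Qed.

Lemma two_parameter_eigenpair_swap (R : realType) (n : nat)
    (A1 B1 C1 D1 A2 B2 C2 D2 : 'M[R[i]]_n)
    (lambda mu : R[i]) (x y : 'cV[R[i]]_n) :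
  two_parameter_eigenpair A1 B1 C1 D1 A2 B2 C2 D2 lambda mu x y ->
  two_parameter_eigenpair A1 C1 B1 D1 A2 C2 B2 D2 mu lambda x y.
Proof.
by case=> x0 y0 eqx eqy; split=> //; rewrite ?eqx ?eqy [mu * _]mulrC;
  congr (_ + _); apply: addrC.
Qed.

Theorem theorem3 (R : realType) (n : nat)
    (A1 B1 C1 D1 A2 B2 C2 D2 : 'M[R[i]]_n)
    (lambda mu : R[i]) (x y : 'cV[R[i]]_n) :
  two_parameter_eigenpair A1 B1 C1 D1 A2 B2 C2 D2 lambda mu x y ->
  quadratic_eigenpair
    (D1 *t B2 - B1 *t D2)
    (A1 *t D2 - D1 *t A2 - B1 *t C2 + C1 *t B2)
    (A1 *t C2 - C1 *t A2)
    lambda (kron_vec x y)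
  /\
  quadratic_eigenpair
    (D1 *t C2 - C1 *t D2)
    (A1 *t D2 - D1 *t A2 - C1 *t B2 + B1 *t C2)
    (A1 *t B2 - B1 *t A2)
    mu (kron_vec x y).
Proof.
move=> sol; split; first by apply: quadratic_eigenpair_first sol.
by apply: quadratic_eigenpair_first; apply: two_parameter_eigenpair_swap sol.
Qed.
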